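(* For every function $g:\mathbb{Z}\times\mathbb{Z}\rightarrow\mathbb{R}$ there exists a function $f:\mathbb{Z}\times\mathbb{Z}\rightarrow\mathbb{R}$ such that the following holds. Let $H>M<K$ be a primitive amalgam of finite groups with $|H:M|=h$ and $|K:M|=k$, and suppose that at least one of $H$, $K$ has an abelian normal subgroup of index at most $g(h,k)$ (that is, either $H$ or $K$ is abelian by $(h,k)$-bounded). Then $|H|\le f(h,k)$ and $|K|\le f(h,k)$.
   Context: A triple of finite groups $(H,M,K)$, written $H>M<K$, is called a primitive amalgam if $M$ is a proper subgroup of both $H$ and $K$ and: (i) whenever $A$ is a non-trivial normal subgroup of $H$ contained in $M$, we have $N_K(A)=M$; and (ii) whenever $B$ is a non-trivial normal subgroup of $K$ contained in $M$, we have $N_H(B)=M$. A quantity is $(h,k)$-bounded if it can be bounded above by a function of $h$ and $k$ only. A finite group is abelian by $(h,k)$-bounded if it has an abelian normal subgroup whose index is $(h,k)$-bounded. *)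

(* Defs.v *)
From HB Require Import structures.
From mathcomp Require Import all_boot all_order all_algebra all_fingroup.
From mathcomp Require Import reals.

Set Implicit Arguments.
Unset Strict Implicit.
Unset Printing Implicit Defensive.

Import Order.TTheory GRing.Theory Num.Theory.

(* H and K live in unrelated group types, since an amalgam comes without an
   ambient group.  The common subgroup M is given with two embeddings iH and
   iK; a subgroup A of M is viewed in H as iH @* A and in K as iK @* A. *)
Definition is_amalgam (hT mT kT : finGroupType)
    (H : {group hT}) (M : {group mT}) (K : {group kT})
    (iH : {morphism M >-> hT}) (iK : {morphism M >-> kT}) : Prop :=
  [/\ 'injm iH, 'injm iK, iH @* M \subset H & iK @* M \subset K]%g.

Definition primitive_amalgam (hT mT kT : finGroupType)
    (H : {group hT}) (M : {group mT}) (K : {group kT})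
    (iH : {morphism M >-> hT}) (iK : {morphism M >-> kT}) : Prop :=
  [/\ is_amalgam H K iH iK,
      (iH @* M \proper H)%g,
      (iK @* M \proper K)%g,
      (forall A : {group mT}, A \subset M -> A :!=: 1%g ->
         (iH @* A <| H)%g -> ('N_K(iK @* A) = iK @* M)%g) &
      (forall B : {group mT}, B \subset M -> B :!=: 1%g ->
         (iK @* B <| K)%g -> ('N_H(iH @* B) = iH @* M)%g)].

Definition abelian_by_bounded (R : realType) (gT : finGroupType)
    (G : {group gT}) (b : R) : Prop :=
  exists A : {group gT},
    [/\ (A <| G)%g, abelian A & (#|G : A|%g%:R <= b :> R)%R].

(* Main.v *)
Require Import Defs.
From mathcomp Require Import all_boot all_order all_algebra all_fingroup.
From mathcomp Require Import reals.

(** Identify [M] with its images, and let [X0 <= M] be an abelian subgroup of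
    bounded index, normal in [H].  Alternately taking cores in [K] and in [H]
    gives a chain [X0 >= X1 >= X2 >= ...] of subgroups of bounded index in [M];
    if [M] is large, its first terms are non-trivial.  The centralizers in [M]
    of the [Xi] increase and contain [X0], so two consecutive ones agree after
    boundedly many steps.  If X(i+1) and X(i+2) are non-trivial, primitivity
    puts the centralizer of [Xi] in the ambient group normalizing it inside
    [N(X(i+1)) = M], and similarly for X(i+1); so a common centralizer would be
    normal in both [H] and [K], which is impossible. *)

Set Implicit Arguments.
Unset Strict Implicit.
Unset Printing Implicit Defensive.

Local Open Scope group_scope.

(** The action on [S] embeds the quotient by the pointwise stabilizer in the symmetric group of
    [S]. *)
Lemma index_astab_le_fact (aT : finGroupType) (D : {group aT})
    (rT : finType) (to : action D rT) (G : {group aT}) (S : {set rT}) :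
  [acts G, on S | to] -> #|G : 'C_G(S | to)| <= #|S|`!.
Proof.
move=> nSG; pose f := [morphism of actperm <[nSG]>].
have kerf : 'ker f = 'C_G(S | to) by rewrite ker_actperm astab_actby setIT.
have -> : #|G : 'C_G(S | to)| = #|f @* G|
  by rewrite card_morphim setIid kerf.
rewrite -card_Sym subset_leq_card //.
apply/subsetP=> _ /morphimP[x Gx _ ->]; rewrite inE.
apply/subsetP=> y; rewrite inE actpermE /= /actby; case: ifP => [/andP[]//|].
by rewrite eqxx.
Qed.

(** The core is the kernel of the action of [G] on the cosets of [X]. *)
Lemma index_gcore_le_fact (gT : finGroupType) (G X : {group gT}) :
  X \subset G -> #|G : gcore X G| <= #|G : X|`!.
Proof.
move=> sXG; have := @index_astab_le_fact _ _ _ _ _ _ (actsRs_rcosets X G).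
by rewrite astabRs_rcosets (setIidPr (subset_trans (gcore_sub _ _) sXG)).
Qed.

Section Embedding.

Variables (hT mT : finGroupType) (H : {group hT}) (M : {group mT}).
Variable (i : {morphism M >-> hT}).
Hypotheses (inj_i : 'injm i) (sMH : i @* M \subset H).

Lemma index_embed (X : {group mT}) :
  X \subset M -> #|H : i @* X| = (#|H : i @* M| * #|M : X|)%N.
Proof.
by move=> sXM; rewrite -(index_injm _ inj_i) // Lagrange_index ?morphimS.
Qed.

Lemma ex_core_embed (X : {group mT}) : X \subset M ->
  exists Y : {group mT}, [/\ Y \subset X, i @* Y <| H &
    #|M : Y| <= (#|H : i @* M| * #|M : X|)`!].
Proof.
move=> sXM; pose Y := [group of i @*^-1 (gcore (i @* X) H)].
have sYX : Y \subset X.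
  by rewrite -(injmK inj_i sXM) morphpreS ?gcore_sub.
have iY : i @* Y = gcore (i @* X) H.
  by rewrite morphpreK ?(subset_trans (gcore_sub _ _)) ?morphimS.
have sXH : i @* X \subset H by rewrite (subset_trans _ sMH) ?morphimS.
have sYM := subset_trans sYX sXM.
exists Y; split=> //; first by rewrite iY gcore_normal.
rewrite -(index_embed sXM); apply: leq_trans (index_gcore_le_fact sXH).
by rewrite -iY (index_embed sYM) leq_pmull ?indexg_gt0.
Qed.

(** The hypothesis on ['C_H(i @* X)] makes it the image of ['C_M(X)], and the centralizer of a
    normal subgroup is normal. *)
Lemma cent_embed_normal (X : {group mT}) :
    X \subset M -> i @* X <| H -> 'C_H(i @* X) \subset i @* M ->
  i @* 'C_M(X) <| H.
Proof.
move=> sXM nXH sCM; rewrite injm_subcent //.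
have -> : 'C_(i @* M)(i @* X) = 'C_H(i @* X).
  apply/eqP; rewrite eqEsubset setSI //= subsetI sCM subsetIr //.
by rewrite /normal subsetIl normsI ?normG // norms_cent ?normal_norm.
Qed.

End Embedding.

Section Primitive.

Implicit Types hT mT kT : finGroupType.

Lemma primitive_amalgam_sym hT mT kT (H : {group hT}) (M : {group mT})
    (K : {group kT}) (iH : {morphism M >-> hT}) (iK : {morphism M >-> kT}) :
  primitive_amalgam H K iH iK -> primitive_amalgam K H iK iH.
Proof. by case=> [[? ? ? ?] ? ? ? ?]; split. Qed.

(** Centralizing [X] implies normalizing [Y], and primitivity identifies the normalizer of [Y] in
    [H] with [M]. *)
Lemma primitive_cent_sub hT mT kT (H : {group hT}) (M : {group mT})
    (K : {group kT}) (iH : {morphism M >-> hT}) (iK : {morphism M >-> kT})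
    (X Y : {group mT}) :
    primitive_amalgam H K iH iK -> X \subset M -> Y \subset X ->
    Y :!=: 1 -> iK @* Y <| K ->
  'C_H(iH @* X) \subset iH @* M.
Proof.
case=> _ _ _ _ primK sXM sYX ntY nYK.
rewrite -(primK _ (subset_trans sYX sXM) ntY nYK) setIS //.
by rewrite (subset_trans (centS (morphimS _ sYX))) ?cent_sub.
Qed.

(* [c] bounds the index of the centralizer of the current term of the chain,
   [n] the index of the term itself; [h] and [k] swap at each step. *)
Fixpoint amalgam_bound (c h k n : nat) : nat :=
  if c is c'.+1 then
    let n' := ((k * n)`!)%N in
    (n + n' + (h * n')`! + amalgam_bound c' k h n')%N
  else 0%N.

Lemma abelian_normal_bound (c : nat) hT mT kT (H : {group hT})
    (M : {group mT}) (K : {group kT})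
    (iH : {morphism M >-> hT}) (iK : {morphism M >-> kT})
    (X : {group mT}) (n : nat) :
    primitive_amalgam H K iH iK ->
    X \subset M -> abelian X -> iH @* X <| H ->
    #|M : X| <= n -> #|M : 'C_M(X)| <= c ->
  #|M| <= amalgam_bound c #|H : iH @* M| #|K : iK @* M| n.
Proof.
elim: c => [|c IHc] in hT kT H K iH iK X n *.
  by move=> _ _ _ _ _; rewrite leqNgt indexg_gt0.
move=> prim sXM abX nXH leXn leCc /=.
have [[injH injK sMH sMK] _ ltMK primH _] := prim.
set h := #|H : iH @* M|; set k := #|K : iK @* M|.
have [X1 | ntX] := eqVneq (X : {set mT}) 1.
  by rewrite -!addnA (leq_trans _ (leq_addr _ _)) // -indexg1 -X1.
have [Y [sYX nYK leYn]] := ex_core_embed injK sMK sXM.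
have sYM := subset_trans sYX sXM.
have {}leYn : #|M : Y| <= (k * n)`!.
  by rewrite (leq_trans leYn) // leq_fact // leq_mul2l leXn orbT.
have [Z [sZY nZH leZn]] := ex_core_embed injH sMH sYM.
have {}leZn : #|M : Z| <= (h * (k * n)`!)`!.
  by rewrite (leq_trans leZn) // leq_fact // leq_mul2l leYn orbT.
(* A trivial [Z] has index [#|M|], which the third summand of the bound covers. *)
have [Z1 | ntZ] := eqVneq (Z : {set mT}) 1.
  move: leZn; rewrite Z1 indexg1 => leMn.
  by rewrite (leq_trans leMn) // addnAC leq_addl.
have ntY : Y :!=: 1 by apply: contraNneq ntZ => Y1; rewrite -subG1 -Y1.
have cXM := primitive_cent_sub prim sXM sYX ntY nYK.
have cYM := primitive_cent_sub (primitive_amalgam_sym prim) sYM sZY ntZ nZH.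
have nCH := cent_embed_normal injH sMH sXM nXH cXM.
have nCK := cent_embed_normal injK sMK sYM nYK cYM.
have sCXY : 'C_M(X) \subset 'C_M(Y) by rewrite setIS ?centS.
(* A common centralizer contains the abelian group [X], so it is non-trivial. Being normal in [H]
   and in [K], it forces [K] to equal the image of [M]. *)
have [eqC | neqC] := eqVneq 'C_M(X) 'C_M(Y).
  have ntC : 'C_M(X) != 1.
    by apply: contraNneq ntX => C1; rewrite -subG1 -C1 subsetI sXM.
  have := primH _ (subsetIl _ _) ntC nCH.
  rewrite /= eqC (setIidPl (normal_norm nCK)) => eqK.
  by move: ltMK; rewrite -eqK properxx.
have ltC : #|M : 'C_M(Y)| < #|M : 'C_M(X)|.
  have prC : 'C_M(X) \proper 'C_M(Y) by rewrite properEneq neqC.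
  rewrite -(Lagrange_index (subsetIl M 'C(Y)) sCXY) ltn_Pmulr ?indexg_gt0 //.
  by rewrite indexg_gt1 proper_subn.
rewrite (leq_trans _ (leq_addl _ _)) //.
(* The centralizer index has dropped, so induction applies to [Y] with [H] and [K] exchanged. *)
apply: (IHc _ _ _ _ _ _ Y) (primitive_amalgam_sym prim) sYM _ nYK leYn _.
  exact: abelianS abX.
by rewrite -ltnS (leq_trans ltC).
Qed.

(** Here [n] bounds the index in [M] of the core in [H] of the abelian subgroup cut down to [M]. It
    also bounds the centralizer index, as that core is abelian. *)
Definition abelian_amalgam_bound (h k b : nat) : nat :=
  let n := ((h * b)`!)%N in amalgam_bound n h k n.

Lemma abelian_by_bounded_bound (R : realType) hT mT kT (H : {group hT})
    (M : {group mT}) (K : {group kT})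
    (iH : {morphism M >-> hT}) (iK : {morphism M >-> kT}) (b : R) :
    primitive_amalgam H K iH iK -> abelian_by_bounded H b ->
  #|M| <= abelian_amalgam_bound #|H : iH @* M| #|K : iK @* M| (Num.truncn b).
Proof.
move=> prim [A [nAH abA]] leAb; set b' := Num.truncn b.
have {}leAb : #|H : A| <= b'.
  rewrite Num.Theory.truncn_ge_nat //.
  exact: Order.POrderTheory.le_trans (Num.Theory.ler0n _ _) leAb.
have [[injH injK sMH sMK] _ _ _ _] := prim.
set h := #|H : iH @* M|.
pose X0 := [group of iH @*^-1 A].
have sX0M : X0 \subset M by apply: subsetIl.
have iX0 : iH @* X0 = iH @* M :&: A by rewrite /= -morphpreIim morphpreK ?subsetIl.
have abX0 : abelian X0.
  by rewrite -(injm_abelian injH) // (abelianS _ abA) // iX0 subsetIr.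
have leX0 : #|M : X0| <= b'.
  rewrite -(index_injm _ injH) // iX0.
  have [_ nAH'] := andP nAH.
  (* The image of [M] in [H / A] has order at most [#|H : A|]. *)
  rewrite indexgI -card_quotient ?(subset_trans sMH) //.
  by rewrite (leq_trans _ leAb) // -card_quotient // subset_leq_card ?quotientS.
have [X [sXX0 nXH leX]] := ex_core_embed injH sMH sX0M.
have sXM := subset_trans sXX0 sX0M.
have abX := abelianS sXX0 abX0.
have {}leX : #|M : X| <= (h * b')`!.
  by rewrite (leq_trans leX) // leq_fact // leq_mul2l leX0 orbT.
apply: (abelian_normal_bound prim sXM abX nXH leX).
apply: leq_trans leX; rewrite dvdn_leq ?indexg_gt0 //.
by rewrite indexgS // subsetI sXM.
Qed.

End Primitive.

Theorem theorem1p2 (R : realType) (g : int * int -> R) :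
  exists f : int * int -> R,
    forall (hT mT kT : finGroupType)
           (H : {group hT}) (M : {group mT}) (K : {group kT})
           (iH : {morphism M >-> hT}) (iK : {morphism M >-> kT})
           (h k : nat),
      primitive_amalgam H K iH iK ->
      #|H : (iH @* M)%g|%g = h ->
      #|K : (iK @* M)%g|%g = k ->
      abelian_by_bounded H (g (h%:Z, k%:Z)%R) \/
      abelian_by_bounded K (g (h%:Z, k%:Z)%R) ->
      (#|H|%:R <= f (h%:Z, k%:Z) :> R)%R /\
      (#|K|%:R <= f (h%:Z, k%:Z) :> R)%R.
Proof.
(* The sum covers both cases, whichever of [H] and [K] is abelian by bounded. *)
pose m h k b := (abelian_amalgam_bound h k b + abelian_amalgam_bound k h b)%N.
exists (fun hk => let: (h, k) := (absz hk.1, absz hk.2) in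
  ((h + k) * m h k (Num.truncn (g hk)))%:R%R).
move=> hT mT kT H M K iH iK h k prim eqh eqk ab /=.
have leM : #|M| <= m h k (Num.truncn (g (Posz h, Posz k))).
  rewrite /m; case: ab => /abelian_by_bounded_bound le_m.
    by rewrite (leq_trans (le_m _ _ _ _ _ _ prim)) // eqh eqk leq_addr.
  have := le_m _ _ _ _ _ _ (primitive_amalgam_sym prim); rewrite eqh eqk => leMk.
  by rewrite (leq_trans leMk) ?leq_addl.
have [[injH injK sMH sMK] _ _ _ _] := prim.
rewrite !Num.Theory.ler_nat -(Lagrange sMH) -(Lagrange sMK) eqh eqk !card_injm //.
by split; rewrite mulnC leq_mul ?leq_addr ?leq_addl.
Qed.
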